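(* Let $H_1,H_2,V_1,V_2$ be complex Hilbert spaces with $V_k$ densely (and continuously) embedded in $H_k$ for $k\in\{1,2\}$. For $k\in\{1,2\}$ let $a_k\colon V_k\times V_k\to\mathbb{C}$ be a continuous elliptic sesquilinear form, let $A_k$ be the operator in $H_k$ associated with $a_k$, and let $S^k=(S^k_t)_{t>0}$ be the semigroup on $H_k$ generated by $-A_k$. Let $\Phi\in\mathcal{L}(H_1,H_2)$ be invertible. Consider the following statements. (i) $\Phi(D(A_1))\subset D(A_2)$ and $A_2\,\Phi u=\Phi\,A_1u$ for all $u\in D(A_1)$. (ii) $\Phi(D(A_1))=D(A_2)$ and $A_2\,\Phi u=\Phi\,A_1u$ for all $u\in D(A_1)$. (iii) $\Phi^{-1}\,S^2_t\,\Phi=S^1_t$ for all $t>0$. (iv) If $u\in D(A_1)$ and $\lambda\in\mathbb{R}$ are such that $A_1u=\lambda u$, then $\Phi u\in D(A_2)$ and $A_2\Phi u=\lambda\Phi u$. Then (i), (ii) and (iii) are equivalent, and they imply (iv). If in addition $A_1$ is self-adjoint and has compact resolvent, then all four statements are equivalent.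
   Context: A continuous sesquilinear form $a\colon V\times V\to\mathbb{C}$, where $V$ is densely embedded in the Hilbert space $H$, is called elliptic if there exist $\omega\in\mathbb{R}$ and $\mu>0$ such that $\operatorname{Re}a(u,u)+\omega\|u\|_H^2\ge\mu\|u\|_V^2$ for all $u\in V$. The operator $A$ in $H$ associated with $a$ has domain $D(A)=\{u\in V:\text{there is an } f\in H \text{ with } a(u,v)=(f,v)_H\text{ for all }v\in V\}$, and $Au=f$ for such $u,f$. Then $-A$ generates a holomorphic $C_0$-semigroup on $H$. $\mathcal{L}(H_1,H_2)$ denotes the bounded linear operators from $H_1$ to $H_2$. *)

(* Defs.v *)
From HB Require Import structures.
From mathcomp Require Import all_boot all_order all_algebra.
From mathcomp Require Import all_classical all_reals all_analysis.
From mathcomp Require Import complex.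

Set Implicit Arguments.
Unset Strict Implicit.
Unset Printing Implicit Defensive.

Import Order.TTheory GRing.Theory Num.Theory.
Import numFieldNormedType.Exports.

Local Open Scope classical_set_scope.
Local Open Scope complex_scope.
Local Open Scope ring_scope.

(** The scalar field is [R[i]] for [R : realType]. The norm of a normed module
    over [R[i]] takes its values in [R[i]]; they are real and nonnegative, and
    [<=] on [R[i]] compares complex numbers with equal imaginary parts. *)

HB.mixin Record CompleteNormedModule_isHilbert (R : realType) H
    of CompleteNormedModule R[i] H := {
  inner : {dot H for @Num.conj R[i]};
  inner_norm : forall u : H, inner u u = `|u| ^+ 2
}.

#[short(type="hilbertType")]
HB.structure Definition Hilbert (R : realType) :=
  {H of CompleteNormedModule R[i] H & CompleteNormedModule_isHilbert R H}.

(** Unbounded operators: the values of [app] outside [dom] are irrelevant. *)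
Record operator (H : Type) := Operator { dom : set H; app :> H -> H }.

Definition eq_operator (H : Type) (A B : operator H) :=
  dom A = dom B /\ forall u, dom A u -> A u = B u.

Definition opp_operator (H : zmodType) (A : operator H) : operator H :=
  Operator (dom A) (fun u => - A u).

Section Forms.
Variables (R : realType) (V H : hilbertType R).

Definition dense_embedding (j : {linear V -> H}) :=
  [/\ continuous j, injective j & dense (range j)].

(** Linear in the first argument and conjugate-linear in the second one. *)
Definition sesquilinear_form :=
  {bilinear V -> V -> R[i] | *%R & (@Num.conj R[i]) \; *%R}.

Definition continuous_form (a : sesquilinear_form) :=
  continuous (fun p : V * V => a p.1 p.2 : R[i]^o).

Definition elliptic (j : {linear V -> H}) (a : sesquilinear_form) :=
  exists omega mu : R, 0 < mu /\
    forall u : V, mu%:C * `|u| ^+ 2 <= 'Re (a u u) + omega%:C * `|j u| ^+ 2.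

(** [x] belongs to the domain, and is mapped to [f]. The value [f] is unique
    when [j] has dense range. *)
Definition associated_graph (j : {linear V -> H}) (a : sesquilinear_form)
    (x f : H) :=
  exists2 u : V, j u = x & forall v : V, a u v = inner f (j v).

Definition associated_operator (j : {linear V -> H}) (a : sesquilinear_form) :
    operator H :=
  Operator [set x | exists f, associated_graph j a x f]
           (fun x => xget 0 [set f | associated_graph j a x f]).

End Forms.

Section Operators.
Variables (R : realType) (H : hilbertType R).

(** Only the operators [S t] with [0 < t] are constrained. *)
Definition C0_semigroup (S : R -> {linear H -> H}) :=
  [/\ forall t : R, 0 < t -> continuous (S t),
      forall s t : R, 0 < s -> 0 < t -> forall x, S (s + t) x = S s (S t x) &
      forall x : H, S t x @[t --> (0 : R)^'+] --> x].

Definition generator (S : R -> {linear H -> H}) : operator H :=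
  let quotient (x : H) (t : R) := (t^-1)%:C *: (S t x - x) in
  Operator [set x | cvg (quotient x t @[t --> (0 : R)^'+])]
           (fun x => lim (quotient x t @[t --> (0 : R)^'+])).

Definition semigroup_generated_by (B : operator H) (S : R -> {linear H -> H}) :=
  C0_semigroup S /\ eq_operator (generator S) B.

Definition adjoint (A : operator H) : operator H :=
  let graph (v g : H) := forall u, dom A u -> inner (A u) v = inner u g in
  Operator [set v | exists g, graph v g]
           (fun v => xget 0 [set g | graph v g]).

Definition self_adjoint (A : operator H) :=
  dense (dom A) /\ eq_operator (adjoint A) A.

(** [K] is the bounded inverse of [lambda - A]. *)
Definition is_resolvent (A : operator H) (lambda : R[i]) (K : {linear H -> H}) :=
  [/\ continuous K,
      forall f, dom A (K f) /\ lambda *: K f - A (K f) = f &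
      forall u, dom A u -> K (lambda *: u - A u) = u].

Definition compact_operator (K : {linear H -> H}) :=
  precompact (K @` [set x | `|x| <= 1]).

Definition has_compact_resolvent (A : operator H) :=
  exists (lambda : R[i]) (K : {linear H -> H}),
    is_resolvent A lambda K /\ compact_operator K.

End Operators.

(* Main.v *)
(** The operators [- A_k] are quasi-dissipative, so by Gronwall's inequality for
    right derivatives an orbit of [- A_2] starting at [0] vanishes. This applies
    to [t |-> S^2_t Phi x - Phi S^1_t x] whenever [x] lies in an
    [S^1]-invariant set on which [Phi] intertwines [A_1] and [A_2]; left
    continuity of the orbits comes from uniform boundedness. For (i) that set is
    [D(A_1)], for (iv) it is an eigenspace of [A_1]. Both [D(A_1)] and, if [A_1]
    is self-adjoint with compact resolvent, the union of the eigenspaces have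
    trivial orthogonal complement: this uses [(omega + A_1)^{-1}], which exists
    by Lax-Milgram, is positive, and inherits compactness from the given
    resolvent. Hence (iii), which gives (ii) by differentiating at [t = 0]. *)

Require Import Defs.
From mathcomp Require Import all_boot all_order all_algebra.
From mathcomp Require Import all_classical all_reals all_analysis.
From mathcomp Require Import complex.
From mathcomp Require Import ring lra.

Set Implicit Arguments.
Unset Strict Implicit.
Unset Printing Implicit Defensive.

Import Order.TTheory GRing.Theory Num.Theory.
Import numFieldNormedType.Exports.

Local Open Scope classical_set_scope.
Local Open Scope complex_scope.
Local Open Scope ring_scope.

(** * The underlying real Hilbert space: real scalar product and real-valued norm *)

Lemma Re_conj {R : rcfType} (z : R[i]) : complex.Re (Num.conj z) = complex.Re z.
Proof. by case: z. Qed.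

(** Testing on [i v] in a conjugate-linear slot turns a real part into an imaginary part; this lifts
    real identities to complex ones. *)
Lemma Re_conji {R : rcfType} (z : R[i]) :
  complex.Re (Num.conj ('i%C : R[i]) * z) = complex.Im z.
Proof. by case: z => a b /=; rewrite mul0r sub0r mulNr mul1r opprK. Qed.

Section RealStructure.
Context {R : realType} {H : hilbertType R}.
Implicit Types (x y z : H) (r : R).

Definition hnorm x : R := complex.Re `|x|.

(** The scalar product of the underlying real Hilbert space; the variational and spectral arguments
    below use only real linearity. *)
Definition rdot x y : R := complex.Re (inner x y).

Lemma hnormE x : `|x| = (hnorm x)%:C.
Proof. by rewrite /hnorm RRe_real// normr_real. Qed.

Lemma hnorm_ge0 x : 0 <= hnorm x.
Proof. by rewrite -ler0c -hnormE. Qed.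

Lemma hnorm0 : hnorm 0 = 0.
Proof. by rewrite /hnorm normr0. Qed.

Lemma hnorm0_eq0 x : hnorm x = 0 -> x = 0.
Proof. by move=> x0; apply/eqP; rewrite -normr_eq0 hnormE x0. Qed.

Lemma hnorm_gt0 x : (0 < hnorm x) = (x != 0).
Proof. by rewrite -ltcR -hnormE normr_gt0. Qed.

Lemma hnormZ (c : R[i]) x : hnorm (c *: x) = complex.Re `|c| * hnorm x.
Proof.
have /RRe_real cE : `|c| \is Num.real by exact: normr_real.
by rewrite /hnorm normrZ hnormE -[X in X * _]cE -rmorphM.
Qed.

Lemma hnormZr r x : hnorm (r%:C *: x) = `|r| * hnorm x.
Proof. by rewrite hnormZ normc_def /= expr0n addr0 sqrtr_sqr. Qed.

Lemma hnormN x : hnorm (- x) = hnorm x.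
Proof. by rewrite /hnorm normrN. Qed.

Lemma hnormB x y : hnorm (x - y) = hnorm (y - x).
Proof. by rewrite /hnorm distrC. Qed.

Lemma hnormD_le x y : hnorm (x + y) <= hnorm x + hnorm y.
Proof. by rewrite -lecR rmorphD /= -!hnormE ler_normD. Qed.

Lemma hnormB_le x y : hnorm (x - y) <= hnorm x + hnorm y.
Proof. by rewrite -[hnorm y]hnormN hnormD_le. Qed.

Lemma hnorm_dist3 x y z : hnorm (x - z) <= hnorm (x - y) + hnorm (y - z).
Proof. by rewrite -[x - z](subrKA y) hnormD_le. Qed.

Lemma rdotC x y : rdot x y = rdot y x.
Proof.
rewrite /rdot (hermC (inner : {dot H for _})) expr0 mul1r.
exact: Re_conj.
Qed.

Lemma rdotDl x y z : rdot (x + y) z = rdot x z + rdot y z.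
Proof. by rewrite /rdot linearDl raddfD. Qed.

Lemma rdotDr x y z : rdot z (x + y) = rdot z x + rdot z y.
Proof. by rewrite rdotC rdotDl !(rdotC z). Qed.

Lemma rdot0l x : rdot 0 x = 0.
Proof. by rewrite /rdot linear0l. Qed.

Lemma rdot0r x : rdot x 0 = 0.
Proof. by rewrite rdotC rdot0l. Qed.

Lemma rdotNl x z : rdot (- x) z = - rdot x z.
Proof. by rewrite /rdot linearNl raddfN. Qed.

Lemma rdotNr x z : rdot z (- x) = - rdot z x.
Proof. by rewrite rdotC rdotNl (rdotC z). Qed.

Lemma rdotBl x y z : rdot (x - y) z = rdot x z - rdot y z.
Proof. by rewrite rdotDl rdotNl. Qed.

Lemma rdotBr x y z : rdot z (x - y) = rdot z x - rdot z y.
Proof. by rewrite rdotDr rdotNr. Qed.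

Lemma ReZr r (c : R[i]) : complex.Re (r%:C * c) = r * complex.Re c.
Proof. by case: c => a b /=; rewrite mul0r subr0. Qed.

Lemma rdotZl r x y : rdot (r%:C *: x) y = r * rdot x y.
Proof. by rewrite /rdot linearZl_LR/= ReZr. Qed.

Lemma rdotZr r x y : rdot y (r%:C *: x) = r * rdot y x.
Proof. by rewrite rdotC rdotZl rdotC. Qed.

Lemma rdot_norm x : rdot x x = hnorm x ^+ 2.
Proof. by rewrite /rdot inner_norm hnormE -rmorphXn. Qed.

Lemma hnorm_sqrD x y :
  hnorm (x + y) ^+ 2 = hnorm x ^+ 2 + 2 * rdot x y + hnorm y ^+ 2.
Proof.
by rewrite -!rdot_norm !rdotDl !rdotDr (rdotC y x); ring.
Qed.

Lemma hnorm_sqrB x y :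
  hnorm (x - y) ^+ 2 = hnorm x ^+ 2 - 2 * rdot x y + hnorm y ^+ 2.
Proof. by rewrite hnorm_sqrD hnormN rdotNr; ring. Qed.

(** Cauchy-Schwarz obtained by squaring the triangle inequality, which comes with the normed
    structure. *)
Lemma rdot_le x y : rdot x y <= hnorm x * hnorm y.
Proof.
have := hnorm_sqrD x y; have := hnormD_le x y.
have := hnorm_ge0 (x + y); have := hnorm_ge0 x; have := hnorm_ge0 y.
by nra.
Qed.

Lemma rdot_abs_le x y : `|rdot x y| <= hnorm x * hnorm y.
Proof. by rewrite ler_norml rdot_le andbT lerNl -rdotNl -[hnorm x]hnormN rdot_le. Qed.

(** Written as a midpoint convexity identity, the form required by [strongly_convex_min]. *)
Lemma parallelogram x y :
  hnorm (2^-1%:C *: (x + y)) ^+ 2 =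
  (hnorm x ^+ 2 + hnorm y ^+ 2) / 2 - hnorm (x - y) ^+ 2 / 4.
Proof.
rewrite hnormZr exprMn hnorm_sqrB hnorm_sqrD ger0_norm ?invr_ge0//.
by field.
Qed.

(** A positive element of [R[i]] is real, so complex radii reduce to radii in [R]. *)
Lemma cvg_hnormP {T} {F : set_system T} {FF : Filter F} (f : T -> H) (l : H) :
  f @ F --> l <-> forall e : R, 0 < e -> \forall t \near F, hnorm (f t - l) < e.
Proof.
split=> [/cvgrPdist_lt fl e e0|fl].
  have /fl : 0 < e%:C by rewrite ltcR.
  by apply: filterS => t; rewrite hnormE ltcR hnormB.
apply/cvgrPdist_lt => e e0.
have /RRe_real eE : e \is Num.real by exact: gtr0_real.
rewrite -eE; have /fl : 0 < complex.Re e by rewrite -ltcR eE.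
by apply: filterS => t; rewrite hnormE ltcR hnormB.
Qed.

End RealStructure.

(** * One-sided limits, bounded linear maps and completeness with real bounds *)

Lemma near_at_right0 {R : realType} (P : R -> Prop) :
  (\forall t \near (0 : R)^'+, P t) <->
  exists2 d : R, 0 < d & forall t, 0 < t -> t < d -> P t.
Proof.
split=> [[/= d d0 dP]|[d d0 dP]].
  exists d => // t t0 td; apply: dP => //=.
  by rewrite sub0r normrN gtr0_norm.
exists d => //= t /=; rewrite sub0r normrN => td t0; apply: dP => //.
by rewrite gtr0_norm in td.
Qed.

Section Bounded.
Context {R : realType} {H H' : hilbertType R}.

Lemma linear_real (f : {linear H -> H'}) (r : R) x :
  f (r%:C *: x) = r%:C *: f x.
Proof. exact: linearZ_LR. Qed.

(** Scaled to norm [d / 2], a vector lies in a ball of radius [d] that is mapped into the unit ball;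
    hence the constant [2 / d]. *)
Lemma continuous_linearP (f : {linear H -> H'}) : continuous f ->
  exists2 M : R, 0 < M & forall x, hnorm (f x) <= M * hnorm x.
Proof.
move=> /(_ 0); rewrite /continuous_at linear0 => /cvg_hnormP/(_ 1 ltr01).
move=> /nbhs_ballP[e /= e0]; rewrite -ball_normE/= => ef.
have /RRe_real eE : e \is Num.real by exact: gtr0_real.
have d0 : 0 < complex.Re e by rewrite -ltcR eE.
set d := complex.Re e in eE d0.
exists (2 / d) => [|x]; first by rewrite divr_gt0.
have [->|x0] := eqVneq x 0; first by rewrite linear0 !hnorm0 mulr0.
have n0 : 0 < hnorm x by rewrite hnorm_gt0.
have := ef ((d / 2 / hnorm x)%:C *: x).
rewrite /= sub0r normrN hnormE -eE ltcR subr0 linear_real !hnormZr.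
rewrite gtr0_norm ?divr_gt0// divfK ?gt_eqF// => fx.
have {}fx : d / 2 / hnorm x * hnorm (f x) <= 1.
  by apply/ltW/fx; rewrite ltr_pdivrMr// ltr_pMr// ltr1n.
by move: fx; rewrite -ler_pdivlMl ?divr_gt0// mulr1 !invf_div mulrC mulrAC.
Qed.

End Bounded.

Lemma hilbert_complete {R : realType} {H : hilbertType R} (x : nat -> H) :
  (forall e : R, 0 < e -> exists N, forall m n, (N <= m)%N -> (N <= n)%N ->
    hnorm (x m - x n) < e) ->
  exists l, forall e : R, 0 < e -> exists N, forall n, (N <= n)%N ->
    hnorm (x n - l) < e.
Proof.
move=> cx; have /cvg_ex[l /cvg_hnormP xl] : cvg (x @ \oo).
  apply/cauchy_cvgP/cauchy_exP => e e0.
  have /RRe_real eE : e \is Num.real by exact: gtr0_real.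
  have /cx[N Ne] : 0 < complex.Re e by rewrite -ltcR eE.
  exists (x N); exists N => // n /= Nn.
  by rewrite -ball_normE /= hnormE -eE ltcR; exact: Ne.
by exists l => e /xl[N _ Ne]; exists N => n; exact: Ne.
Qed.

Lemma invn_lt {R : realType} (e : R) : 0 < e ->
  exists N : nat, forall n, (N <= n)%N -> n.+1%:R^-1 < e.
Proof.
move=> e0; exists (Num.truncn e^-1) => n Nn.
rewrite invf_plt ?posrE//; apply: lt_le_trans (truncnS_gt _) _.
by rewrite ler_nat.
Qed.

(** First-order optimality condition. It suffices to test [s = - a / (1 + b)]; the 1 keeps the
    denominator positive when [b = 0]. *)
Lemma linear_coef_eq0 {R : realFieldType} (a b : R) : 0 <= b ->
  (forall s, 0 <= 2 * s * a + s ^+ 2 * b) -> a = 0.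
Proof.
move=> b0 /(_ (- (a / (1 + b)))); have b1 : 0 < 1 + b by rewrite ltr_pwDl.
set q := a / _; have -> : a = q * (1 + b) by rewrite divfK ?gt_eqF.
move=> h; have q0 : q = 0 by nra.
by rewrite q0 mul0r.
Qed.

(** * Minimization of convex functionals, Riesz representation and Lax-Milgram *)

Section Minimization.
Context {R : realType} {V : hilbertType R}.

(** Strong midpoint convexity makes a minimizing sequence Cauchy; the last hypothesis, lower
    semicontinuity, shows that the infimum is attained at its limit. *)
Lemma strongly_convex_min (J : V -> R) (c m0 : R) : 0 < c ->
  (forall u, m0 <= J u) ->
  (forall u v, J (2^-1%:C *: (u + v)) <= (J u + J v) / 2 - c * hnorm (u - v) ^+ 2) ->
  (forall u e, 0 < e -> exists2 d : R, 0 < d &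
    forall v, hnorm (v - u) < d -> J u <= J v + e) ->
  exists w, forall v, J w <= J v.
Proof.
move=> c0 Jm0 Jconv Jlsc.
have hJ : has_inf (range J).
  by split; [exists (J 0), 0|exists m0 => _ [u _ <-]].
set m := inf (range J).
have mJ u : m <= J u by apply: ge_inf; [case: hJ|exists u].
have /choice[x xJ] : forall n, exists u, J u < m + n.+1%:R^-1.
  move=> n; have n0 : (0 : R) < n.+1%:R^-1 by rewrite invr_gt0.
  by have [_ [u _ <-] ?] := inf_adherent n0 hJ; exists u.
have [|w xw] := hilbert_complete (x := x).
  move=> e e0; have [N Ne] := invn_lt (mulr_gt0 c0 (exprn_gt0 2 e0)).
  have xN k : (N <= k)%N -> J (x k) < m + c * e ^+ 2.
    by move=> /Ne kN; apply: lt_trans (xJ k) _; rewrite ltrD2l.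
  exists N => i j /xN xi /xN xj.
  (* The value at the midpoint is at least [m], so [c * d ^+ 2] is at most the mean of the excesses
     of [J (x i)] and [J (x j)] over [m]. *)
  have := mJ (2^-1%:C *: (x i + x j)); have := Jconv (x i) (x j).
  have := hnorm_ge0 (x i - x j).
  set d := hnorm _; set q := J (_ *: _) => d0 Jc mJc.
  have : c * d ^+ 2 < c * e ^+ 2 by lra.
  by rewrite ltr_pM2l// ltr_pXn2r ?nnegrE// ltW.
exists w => v; apply: le_trans (mJ v); apply/ler_addgt0Pr => e e0.
have [d d0 Jd] := Jlsc w _ (divr_gt0 e0 (ltr0Sn _ 1)).
have [N1 xN1] := xw _ d0; have [N2 N2e] := invn_lt (divr_gt0 e0 (ltr0Sn _ 1)).
have := Jd _ (xN1 _ (leq_maxl N1 N2)); have := N2e _ (leq_maxr N1 N2).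
by have := xJ (maxn N1 N2); set k := _^-1; lra.
Qed.

Lemma rdot_eq0_of_min (z y : V) :
  (forall s : R, hnorm z <= hnorm (z + s%:C *: y)) -> rdot z y = 0.
Proof.
move=> zmin; apply: (@linear_coef_eq0 _ _ (hnorm y ^+ 2)); first exact: sqr_ge0.
move=> s; have := zmin s; rewrite -(ler_pXn2r (ltn0Sn 1)) ?nnegrE ?hnorm_ge0//.
rewrite hnorm_sqrD rdotZr hnormZr exprMn real_normK ?num_real//.
by lra.
Qed.

(** The representing vector minimizes [|u|^2 - 2 phi u], which is bounded below by [- C^2] and
    strongly convex with constant 1/4 by the parallelogram law. *)
Lemma riesz_real (phi : V -> R) (C : R) :
  (forall u v, phi (u + v) = phi u + phi v) ->
  (forall (r : R) u, phi (r%:C *: u) = r * phi u) ->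
  (forall u, phi u <= C * hnorm u) ->
  exists w, forall v, phi v = rdot w v.
Proof.
move=> phiD phiZ phiC.
have phiN u : phi (- u) = - phi u.
  by have := phiZ (-1) u; rewrite rmorphN1 scaleN1r mulN1r.
pose J u := hnorm u ^+ 2 - 2 * phi u.
have [||u v|u e e0|w wJ] := @strongly_convex_min J 4^-1 (- C ^+ 2).
- by rewrite invr_gt0.
- by move=> u; rewrite /J; have := phiC u; have := sqr_ge0 (hnorm u - C); lra.
- by rewrite /J parallelogram phiZ phiD; lra.
(* With [d = v - u], [J u - J v <= 2 |u| |d| + 2 C |d| <= M |d|]; the summand 1 makes [M]
   positive. *)
- pose M := 2 * (hnorm u + 1 + `|C|).
  have M0 : 0 < M by rewrite mulr_gt0// ltr_wpDr// ltr_wpDl ?hnorm_ge0.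
  exists (e / M); first by rewrite divr_gt0.
  move=> v; rewrite ltr_pdivlMr// => vu.
  have -> : v = u + (v - u) by rewrite addrC subrK.
  rewrite /J hnorm_sqrD phiD; move: vu; set d := v - u => vu.
  have := rdot_abs_le u d; rewrite ler_norml => /andP[ud _].
  have := phiC d; have := sqr_ge0 (hnorm d); have := ler_norm C.
  have := hnorm_ge0 d; rewrite /M in vu.
  by nra.
exists w => v; apply/esym/eqP; rewrite -subr_eq0; apply/eqP.
apply: (@linear_coef_eq0 _ _ (hnorm v ^+ 2)); first exact: sqr_ge0.
move=> s; have := wJ (w + s%:C *: v).
rewrite /J hnorm_sqrD phiD phiZ rdotZr hnormZr exprMn real_normK ?num_real//.
by lra.
Qed.

(* The solution minimizes [|T u - w|], where [T] and [w] represent [b] and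
   [phi]; a minimizer satisfies [z := T u - w _|_ T z], so that [z = 0] by
   coercivity. *)
Lemma lax_milgram_real (b : V -> V -> R) (phi : V -> R) (B C mu : R) :
  (forall u u' v, b (u + u') v = b u v + b u' v) ->
  (forall (r : R) u v, b (r%:C *: u) v = r * b u v) ->
  (forall u v v', b u (v + v') = b u v + b u v') ->
  (forall (r : R) u v, b u (r%:C *: v) = r * b u v) ->
  (forall u v, b u v <= B * hnorm u * hnorm v) ->
  0 < mu -> (forall u, mu * hnorm u ^+ 2 <= b u u) ->
  (forall u v, phi (u + v) = phi u + phi v) ->
  (forall (r : R) u, phi (r%:C *: u) = r * phi u) ->
  (forall u, phi u <= C * hnorm u) ->
  exists u, forall v, b u v = phi v.
Proof.
move=> bDl bZl bDr bZr bB mu0 bmu phiD phiZ phiC.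
have [w phiw] := riesz_real phiD phiZ phiC.
have /choice[T bT] u : exists w, forall v, b u v = rdot w v.
  exact: (@riesz_real (b u) (B * hnorm u)).
have rdot_inj x y : (forall v, rdot x v = rdot y v) -> x = y.
  move=> xy; apply/eqP; rewrite -subr_eq0; apply/eqP/hnorm0_eq0/eqP.
  by rewrite -sqrf_eq0 -rdot_norm rdotBl xy subrr.
have TD u v : T (u + v) = T u + T v.
  by apply: rdot_inj => x; rewrite rdotDl -!bT bDl.
have TZ r u : T (r%:C *: u) = r%:C *: T u.
  by apply: rdot_inj => x; rewrite rdotZl -!bT bZl.
have TB u v : T (u - v) = T u - T v.
  by have := TZ (-1) v; rewrite TD rmorphN1 !scaleN1r => ->.
have T_le u : mu * hnorm u <= hnorm (T u).
  have := bmu u; rewrite bT => /le_trans/(_ (rdot_le _ _)).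
  have := hnorm_ge0 u; rewrite le_eqVlt => /predU1P[<-|u0].
    by move=> _; rewrite mulr0 hnorm_ge0.
  by rewrite expr2 mulrA ler_pM2r.
(* Testing [bB] on [v = T u] gives [|T u|^2] on the left. The sign of [B] is not known, hence its
   absolute value. *)
have Tbnd u : hnorm (T u) <= `|B| * hnorm u.
  have := bB u (T u); rewrite bT rdot_norm.
  have := hnorm_ge0 (T u); rewrite le_eqVlt => /predU1P[<-|Tu0].
    by move=> _; rewrite mulr_ge0 ?hnorm_ge0.
  rewrite expr2 ler_pM2r// => /le_trans; apply.
  by rewrite ler_wpM2r ?hnorm_ge0 ?ler_norm.
have half : 2^-1%:C *: (w + w) = w :> V.
  rewrite scalerDr -scalerDl -rmorphD/= (_ : 2^-1 + 2^-1 = 1) ?scale1r//.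
  by field.
pose J u := hnorm (T u - w) ^+ 2.
(* The convexity constant is the 1/4 of the parallelogram law times the square of the lower bound
   [mu] of [T]. *)
have [||u v|u e e0|u uJ] := @strongly_convex_min J (mu ^+ 2 / 4) 0.
- by rewrite divr_gt0// exprn_gt0.
- by move=> u; rewrite /J sqr_ge0.
- have -> : J (2^-1%:C *: (u + v)) =
      hnorm (2^-1%:C *: ((T u - w) + (T v - w))) ^+ 2.
    by rewrite /J TZ TD -[in LHS]half -scalerBr opprD addrACA.
  rewrite parallelogram /J opprB addrA subrK -TB.
  have : (mu * hnorm (u - v)) ^+ 2 <= hnorm (T (u - v)) ^+ 2.
    by rewrite ler_pXn2r ?nnegrE ?mulr_ge0 ?hnorm_ge0 ?(ltW mu0)// T_le.
  set t := hnorm (T (u - v)); set p := hnorm (u - v); rewrite exprMn.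
  by lra.
- pose M := 2 * (hnorm (T u - w) + 1) * (`|B| + 1).
  have M0 : 0 < M by rewrite !mulr_gt0// ltr_wpDl ?hnorm_ge0.
  exists (e / M); first by rewrite divr_gt0.
  move=> v; rewrite ltr_pdivlMr// => vu.
  have -> : J v = hnorm ((T u - w) + T (v - u)) ^+ 2.
    by rewrite /J TB [X in _ = hnorm X ^+ 2]addrC subrKA.
  rewrite /J [X in _ <= X + _]hnorm_sqrD.
  have := rdot_abs_le (T u - w) (T (v - u)); rewrite ler_norml => /andP[ud _].
  have := Tbnd (v - u); have := sqr_ge0 (hnorm (T (v - u))).
  have := hnorm_ge0 (T u - w); have := hnorm_ge0 (v - u); rewrite /M in vu.
  have := normr_ge0 B; set r := rdot _ _ in ud *.
  set p := hnorm (v - u) in vu *; set q := hnorm (T (v - u)) in ud *.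
  set s := hnorm (T u - w) in vu ud *; set k := `|B| in vu *.
  move=> k0 p0 s0 _ qk; have : s * q <= s * (k * p) by rewrite ler_wpM2l.
  have : 0 <= p * s by rewrite mulr_ge0.
  have : 0 <= p * k by rewrite mulr_ge0.
  have := sqr_ge0 q.
  by lra.
pose z := T u - w.
have z0 : z = 0.
  have : rdot z (T z) = 0.
    apply: rdot_eq0_of_min => s.
    have := uJ (u + s%:C *: z).
    rewrite /J TD TZ -addrA [_ *: _ - _]addrC addrA ler_pXn2r ?nnegrE//.
    + exact: hnorm_ge0.
    + exact: hnorm_ge0.
  rewrite rdotC -bT => bz; have := bmu z; rewrite bz pmulr_rle0// => z2.
  by apply/hnorm0_eq0/eqP; rewrite -sqrf_eq0 eq_le z2 sqr_ge0.
exists u => v; rewrite bT phiw; congr (rdot _ v).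
by apply/eqP; rewrite -subr_eq0 -/z z0.
Qed.

End Minimization.

(** * The uniform boundedness principle *)

Section UniformBoundedness.
Context {R : realType} {H H' : hilbertType R}.

(** Let [h] be the multiple of [z] of norm [r / 2]. Since [2 T h = T (x + h) - T (x - h)], at one of
    the points [x + h], [x - h] the image is at least as large as [T h]. *)
Lemma large_in_ball (T : {linear H -> H'}) (x z : H) (c r : R) : 0 < r ->
  2 * c / r * hnorm z < hnorm (T z) ->
  exists2 y, hnorm (y - x) <= r / 2 & c < hnorm (T y).
Proof.
move=> r0 Tz.
have z0 : 0 < hnorm z.
  rewrite hnorm_gt0; apply/eqP => z0; move: Tz.
  by rewrite z0 linear0 !hnorm0 mulr0 ltxx.
pose h := (r / 2 / hnorm z)%:C *: z.
have hr : hnorm h = r / 2.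
  by rewrite hnormZr gtr0_norm ?divr_gt0// divfK ?gt_eqF.
have Th : c < hnorm (T h).
  rewrite linear_real hnormZr gtr0_norm ?divr_gt0//.
  rewrite -ltr_pdivrMl ?divr_gt0// !invf_div; apply: le_lt_trans Tz.
  by rewrite le_eqVlt; apply/orP; left; apply/eqP; field; rewrite !gt_eqF.
have [xh|xh] := ltP c (hnorm (T (x + h))).
  by exists (x + h) => //; rewrite addrC addKr hr.
have [xh'|xh'] := ltP c (hnorm (T (x - h))).
  by exists (x - h) => //; rewrite addrC addKr hnormN hr.
have := hnormB_le (T (x + h)) (T (x - h)).
rewrite -linearB/= opprB addrC addrA subrK linearD => hh.
have : hnorm (T h + T h) = 2 * hnorm (T h).
  have -> : T h + T h = 2%:C *: T h.
    by rewrite -[in LHS](scale1r (T h)) -scalerDl -(rmorph1 (real_complex R)) -rmorphD.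
  by rewrite hnormZr ger0_norm.
by lra.
Qed.

(** Otherwise there are nested closed balls such that, on the ball of index [k + 1], some [T n] with
    [n >= k] exceeds [k]; their common point violates the pointwise bound. Only tails in [n] matter,
    so sequences of times tending to 0 are covered. *)
Lemma uniform_boundedness (T : nat -> {linear H -> H'}) :
  (forall n, continuous (T n)) ->
  (forall x, exists (M : R) N, forall n, (N <= n)%N -> hnorm (T n x) <= M) ->
  exists (M : R) N, forall n x, (N <= n)%N -> hnorm (T n x) <= M * hnorm x.
Proof.
move=> Tc Tpt; apply: contrapT => nbd.
have unb (M : R) (N : nat) : exists n x, (N <= n)%N /\ M * hnorm x < hnorm (T n x).
  apply: contrapT => h; apply: nbd; exists M, N => n x Nn.
  by rewrite leNgt; apply/negP => Mx; apply: h; exists n, x.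
(* A pair consists of a centre and a radius. Positivity of the radius is a premise inside the
   existential, so that choice yields a total function; [(0, 0)] is a dummy value. *)
have step (kp : nat * (H * R)) : exists q : H * R, 0 < kp.2.2 ->
    [/\ 0 < q.2, q.2 <= kp.2.2 / 2, hnorm (q.1 - kp.2.1) <= kp.2.2 / 2 &
    exists2 n, (kp.1 <= n)%N &
      forall y, hnorm (y - q.1) <= q.2 -> kp.1%:R < hnorm (T n y)].
  case: kp => k [x r] /=; have [r0|r0] := ltP 0 r; last by exists (0, 0).
  (* The image of the new centre exceeds [k + 1]; a radius at most [B^-1] loses at most 1, which
     leaves [k] on the whole ball. *)
  have [n [z [kn /(large_in_ball x r0)[y yx Ty]]]] := unb (2 * k.+1%:R / r) k.
  have [B B0 TB] := continuous_linearP (Tc n).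
  exists (y, Num.min (r / 2) B^-1) => _ /=; split => //.
  - by rewrite lt_min divr_gt0//= invr_gt0.
  - by rewrite ge_min lexx.
  - exists n => // y'; rewrite le_min => /andP[_].
    rewrite -(ler_pM2l B0) mulfV ?gt_eqF// => y'y.
    have := hnorm_dist3 (T n y) (T n y') 0; rewrite !subr0 -linearB/=.
    have := TB (y - y'); rewrite (hnormB y y').
    by move: y'y Ty; rewrite -natr1; set p := hnorm _; set q := B * p; lra.
have [f fP] := choice step.
pose fix q (k : nat) : H * R := if k is k'.+1 then f (k', q k') else (0, 1).
have r0 k : 0 < (q k).2.
  by elim: k => [|k IH]; [exact: ltr01|have [] := fP (k, q k) IH].
pose x k := (q k).1; pose r k := (q k).2.
have rS k : r k.+1 <= r k / 2 by have [] := fP (k, q k) (r0 k).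
have xS k : hnorm (x k.+1 - x k) <= r k / 2 by have [] := fP (k, q k) (r0 k).
have rk k : r k <= k.+1%:R^-1.
  elim: k => [|k rk]; first by rewrite invr1.
  apply: le_trans (rS k) _; rewrite ler_pdivrMr//; apply: le_trans rk _.
  rewrite mulrC ler_pdivlMr ?ltr0Sn// mulrC ler_pdivrMr// -!natr1.
  by have := ler0n R k; lra.
(* Each increment is at most [r k / 2 <= r k - r k.+1], and the right-hand sides telescope. *)
have x_dist k m : (k <= m)%N -> hnorm (x m - x k) <= r k - r m.
  elim: m => [|m IH]; first by rewrite leqn0 => /eqP->; rewrite !subrr hnorm0.
  rewrite leq_eqVlt => /predU1P[->|/IH]; first by rewrite !subrr hnorm0.
  have := hnorm_dist3 (x m.+1) (x m) (x k); have := xS m; have := rS m.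
  set a := hnorm _; set b := hnorm _; set c := hnorm _.
  by lra.
have [|l xl] := hilbert_complete (x := x).
  move=> e e0; have [N Ne] := invn_lt (divr_gt0 e0 (ltr0Sn _ 1)).
  exists N => m n /x_dist mN /x_dist nN.
  have := hnorm_dist3 (x m) (x N) (x n); rewrite (hnormB (x N)).
  have := r0 m; have := r0 n; have := le_lt_trans (rk N) (Ne N (leqnn N)).
  rewrite -/(r m) -/(r n).
  by move: mN nN; set a := hnorm _; set b := hnorm _; set c := hnorm _; lra.
have lx k : hnorm (l - x k) <= r k.
  apply/ler_addgt0Pr => e e0; have [N Ne] := xl e e0.
  have := hnorm_dist3 l (x (maxn k N)) (x k); rewrite (hnormB l (x (maxn k N))).
  have := Ne _ (leq_maxr k N); have := x_dist _ _ (leq_maxl k N).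
  have := r0 (maxn k N); rewrite -/(r _).
  by set a := hnorm _; set b := hnorm _; set c := hnorm _; lra.
have [M [N TM]] := Tpt l.
pose k := maxn (Num.truncn M).+1 N.
have [_ _ _ [n kn]] := fP (k, q k) (r0 k); move=> /(_ l (lx k.+1)).
rewrite ltNge => /negP; apply; apply: le_trans (TM n _) _.
  exact: leq_trans (leq_maxr _ _) kn.
by apply/ltW/(lt_le_trans (truncnS_gt _)); rewrite ler_nat leq_maxl.
Qed.

End UniformBoundedness.

(** * Strongly continuous semigroups, their generators, and a Gronwall inequality *)

Section Semigroup.
Context {R : realType} {H : hilbertType R} {S : R -> {linear H -> H}}.
Hypothesis C0S : C0_semigroup S.

Let Scont t : 0 < t -> continuous (S t). Proof. by case: C0S => + _ _; apply. Qed.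

Lemma semigroupD s t x : 0 < s -> 0 < t -> S (s + t) x = S s (S t x).
Proof. by move=> s0 t0; case: C0S => _ + _; apply. Qed.

Lemma semigroup_cvg0 x (e : R) : 0 < e ->
  exists2 d : R, 0 < d & forall t, 0 < t -> t < d -> hnorm (S t x - x) < e.
Proof.
by move=> e0; case: C0S => _ _ /(_ x)/cvg_hnormP/(_ _ e0)/near_at_right0.
Qed.

(** A failure would give times [t_n] tending to 0 at which the norm of [S t_n] exceeds [n + 1];
    strong convergence at 0 bounds these operators pointwise, against uniform boundedness. *)
Lemma semigroup_bounded_near0 : exists2 d : R, 0 < d &
  exists2 M : R, 1 <= M & forall t x, 0 < t -> t < d -> hnorm (S t x) <= M * hnorm x.
Proof.
apply: contrapT => nbd.
have /choice[tx txP] (n : nat) : exists tx : R * H,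
    [/\ 0 < tx.1, tx.1 < n.+1%:R^-1 & n.+1%:R * hnorm tx.2 < hnorm (S tx.1 tx.2)].
  apply: contrapT => h; apply: nbd; exists n.+1%:R^-1; first by rewrite invr_gt0.
  exists n.+1%:R => [|t x t0 tn]; first by rewrite ler1n.
  by rewrite leNgt; apply/negP => Stx; apply: h; exists (t, x).
have [|x|M [N MN]] := @uniform_boundedness _ _ _ (fun n => S (tx n).1).
- by move=> n; have [/Scont] := txP n.
- have [d d0 Sd] := semigroup_cvg0 x ltr01; have [N Nd] := invn_lt d0.
  exists (1 + hnorm x), N => n /Nd nd; have [t0 tn _] := txP n.
  have := hnorm_dist3 (S (tx n).1 x) x 0; rewrite !subr0.
  have := Sd _ t0 (lt_trans tn nd).
  by set a := hnorm _; set b := hnorm _; set c := hnorm _; lra.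
pose n := maxn (Num.truncn M).+1 N.
have [_ _] := txP n; have := MN n (tx n).2 (leq_maxr _ _).
rewrite leNgt => + nh; move=> /negP; apply; apply: le_lt_trans nh.
rewrite ler_wpM2r ?hnorm_ge0//; apply/ltW/(lt_le_trans (truncnS_gt _)).
by rewrite ler_nat (leq_trans (leq_maxl _ N)).
Qed.

(** Time is cut into steps of length [d / 2 < d], each costing a factor [M]. *)
Lemma semigroup_locally_bounded (t0 : R) : exists2 C : R, 0 < C &
  forall t x, 0 < t -> t <= t0 -> hnorm (S t x) <= C * hnorm x.
Proof.
have [d d0 [M M1 SM]] := semigroup_bounded_near0.
have M0 : 0 < M by exact: lt_le_trans M1.
pose d' := d / 2; have d'0 : 0 < d' by rewrite divr_gt0.
have Sk (k : nat) t x : 0 < t -> t <= k%:R * d' -> hnorm (S t x) <= M ^+ k * hnorm x.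
  elim: k t x => [|k IH] t x t_gt0; first by rewrite mul0r leNgt t_gt0.
  rewrite exprS => tk; have [td|td] := leP t d'.
    apply: le_trans (SM _ _ t_gt0 _) _; first by rewrite /d' in td; lra.
    rewrite -mulrA ler_pM2l// ler_peMl ?hnorm_ge0//.
    by rewrite exprn_ege1.
  have -> : t = d' + (t - d') by rewrite addrC subrK.
  rewrite semigroupD ?subr_gt0//.
  apply: le_trans (SM _ _ d'0 _) _; first by rewrite /d'; lra.
  rewrite -mulrA ler_pM2l//; apply: IH; first by rewrite subr_gt0.
  by move: tk; rewrite -natr1 mulrDl mul1r lerBlDr.
exists (M ^+ (Num.truncn (t0 / d')).+1); first by rewrite exprn_gt0.
move=> t x t_gt0 tt0; apply: Sk => //; apply: le_trans tt0 _.
by rewrite -ler_pdivrMr// ltW// truncnS_gt.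
Qed.

(** [S s x - S t x = S t (S (s - t) x - x)], where [S t] is bounded uniformly in [t <= s]. *)
Lemma semigroup_left_continuous x (s e : R) : 0 < s -> 0 < e ->
  exists2 d : R, 0 < d &
  forall t, 0 < t -> t < s -> s - d < t -> hnorm (S s x - S t x) < e.
Proof.
move=> s0 e0; have [C C0 SC] := semigroup_locally_bounded s.
have [d d0 Sd] := semigroup_cvg0 x (divr_gt0 e0 C0).
exists d => // t t0 ts sdt.
have -> : s = t + (s - t) by rewrite addrC subrK.
rewrite semigroupD ?subr_gt0// -linearB/=.
apply: le_lt_trans (SC _ _ t0 (ltW ts)) _.
rewrite -ltr_pdivlMl// mulrC; apply: Sd; first by rewrite subr_gt0.
by rewrite ltrBlDl -ltrBlDr.
Qed.

Lemma generatorP x : dom (generator S) x ->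
  ((t^-1)%:C *: (S t x - x) @[t --> (0 : R)^'+] --> generator S x).
Proof. by []. Qed.

Lemma generator_cvg x y : ((t^-1)%:C *: (S t x - x) @[t --> (0 : R)^'+] --> y) ->
  dom (generator S) x /\ generator S x = y.
Proof.
move=> xy; split; first by apply/cvg_ex; exists y.
by apply: cvg_lim => //; exact: norm_hausdorff.
Qed.

(** The difference quotient at [S t x] is the image under [S t] of the one at [x]. *)
Lemma generator_semigroup x t : 0 < t -> dom (generator S) x ->
  dom (generator S) (S t x) /\ generator S (S t x) = S t (generator S x).
Proof.
move=> t0 /generatorP xg; apply: generator_cvg.
have [C C0 SC] := continuous_linearP (Scont t0).
apply/cvg_hnormP => e e0; move/cvg_hnormP : xg => /(_ _ (divr_gt0 e0 C0)).
move=> /near_at_right0[d d0 dq]; apply/near_at_right0; exists d => // h h0 hd.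
rewrite -semigroupD// [h + t]addrC semigroupD// -linearB/= -linear_real -linearB/=.
apply: le_lt_trans (SC _) _; rewrite -ltr_pdivlMl// mulrC.
exact: dq.
Qed.

Lemma generator_near x (e : R) : dom (generator S) x -> 0 < e ->
  exists2 d : R, 0 < d & forall h, 0 < h -> h < d ->
    hnorm ((h^-1)%:C *: (S h x - x) - generator S x) < e.
Proof.
by move=> /generatorP/cvg_hnormP xg e0; move: (xg e e0) => /near_at_right0.
Qed.

Lemma generatorB x y : dom (generator S) x -> dom (generator S) y ->
  dom (generator S) (x - y) /\
  generator S (x - y) = generator S x - generator S y.
Proof.
move=> /generatorP xg /generatorP yg; apply: generator_cvg.
have -> : (fun t : R => (t^-1)%:C *: (S t (x - y) - (x - y))) =
    (fun t => (t^-1)%:C *: (S t x - x)) - (fun t => (t^-1)%:C *: (S t y - y)).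
  apply/funext => t; rewrite !fctE -scalerBr (linearB (S t)); congr (_ *: _).
  by rewrite [in LHS]opprD addrACA -opprD.
exact: cvgB.
Qed.

End Semigroup.

(** The hypotheses say that [g s] is at most the lower limit of [g] from the left, that the upper
    right derivative is at most [K g], and that [g] tends to 0 at 0. Comparison with exponentials of
    the larger rate [K + 1], started at times [a] near 0, forces [g = 0]. *)
Lemma gronwall_right {R : realType} (g : R -> R) (K : R) : 0 < K ->
  (forall t, 0 < t -> 0 <= g t) ->
  (forall s e, 0 < s -> 0 < e -> exists2 d : R, 0 < d &
    forall t, 0 < t -> t < s -> s - d < t -> g s <= g t + e) ->
  (forall t e, 0 < t -> 0 < e -> exists2 d : R, 0 < d &
    forall h, 0 < h -> h < d -> g (t + h) <= g t + h * (K * g t + e)) ->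
  (forall e : R, 0 < e -> exists2 d : R, 0 < d & forall t, 0 < t -> t < d -> g t < e) ->
  forall t, 0 < t -> g t = 0.
Proof.
move=> K0 g0 gleft gright gzero.
have growth (a b e : R) : 0 < a -> a <= b -> 0 < e ->
    g b <= (g a + e) * expR ((K + 1) * (b - a)).
  move=> a0 ab e0; pose G t := (g a + e) * expR ((K + 1) * (t - a)).
  have G0 t : 0 < G t by rewrite mulr_gt0 ?expR_gt0// ltr_wpDl ?g0.
  have GD t h : 0 <= h -> G t * (1 + (K + 1) * h) <= G (t + h).
    have E : (K + 1) * (t + h - a) = (K + 1) * (t - a) + (K + 1) * h by ring.
    move=> h0; rewrite /G E expRD mulrA ler_wpM2l ?(ltW (G0 t))//.
    by rewrite expR_ge1Dx.
  have Ga : g a <= G a by rewrite /G subrr mulr0 expR0 mulr1 lerDl ltW.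
  have Gnd s t : s <= t -> G s <= G t.
    move=> st; rewrite -(subrKC s t); apply: le_trans (GD s _ _); last by rewrite subr_ge0.
    by rewrite ler_peMr ?(ltW (G0 s))// lerDl mulr_ge0 ?subr_ge0// addr_ge0 ?(ltW K0).
  (* Continuation up to [s = sup E]: the left hypothesis gives [g s <= G s], and the right one
     carries the bound past [s] unless [s = b]. *)
  pose E := [set t | a <= t <= b /\ forall r, a <= r <= t -> g r <= G r].
  have Ea : E a.
    split; first by rewrite lexx ab.
    by move=> r /le_anti <-.
  have hE : has_sup E by split; [exists a|exists b => t [/andP[]]].
  have [_ ubE] := hE; set s := sup E.
  have as_ : a <= s by apply: (ub_le_sup ubE).
  have sb : s <= b by apply: ge_sup; [exists a|move=> t [/andP[]]].
  have Es r : a <= r -> r < s -> g r <= G r.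
    move=> ar rs; have [t [_ tG] rt] := sup_adherent (eps := s - r) ltac:(by rewrite subr_gt0) hE.
    by apply: tG; rewrite ar ltW//; move: rt; rewrite -/s opprB addrC subrK.
  have s0 : 0 < s by exact: lt_le_trans as_.
  have gs : g s <= G s.
    move: as_; rewrite le_eqVlt => /predU1P[<-//|as_].
    apply/ler_addgt0Pr => e' e'0; have [d d0 gd] := gleft s e' s0 e'0.
    pose t := Num.max ((a + s) / 2) (s - d / 2).
    have ts : t < s by rewrite gt_max; apply/andP; split; lra.
    have at_ : a <= t by rewrite le_max; apply/orP; left; lra.
    apply: le_trans (gd t (lt_le_trans a0 at_) ts _) _.
      by rewrite lt_max; apply/orP; right; lra.
    by rewrite lerD2r; apply: le_trans (Es t at_ ts) _; apply/Gnd/ltW.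
  move: sb; rewrite le_eqVlt => /predU1P[<-//|sb].
  (* Allowing the error [G s] uses exactly the excess of the rate:
     [K * g s + G s <= (K + 1) * G s]. *)
  have [d d0 gd] := gright s _ s0 (G0 s).
  have step h : 0 <= h -> h < d -> g (s + h) <= G (s + h).
    rewrite le_eqVlt => /predU1P[<- _|h0 hd]; first by rewrite addr0.
    apply: le_trans (gd h h0 hd) _; apply: le_trans (GD s h (ltW h0)).
    have : K * g s <= K * G s by rewrite ler_pM2l.
    move: gs; move: (g s) (G s) => u v uv Kuv.
    have : h * (K * u) <= h * (K * v) by rewrite ler_pM2l.
    by lra.
  pose t := Num.min b (s + d / 2).
  suff /(ub_le_sup ubE) : E t.
    by rewrite leNgt lt_min sb ltrDl divr_gt0.
  have st : s <= t by rewrite le_min (ltW sb) lerDl divr_ge0 ?(ltW d0).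
  split=> [|r /andP[ar rt]]; first by rewrite (le_trans as_ st) ge_min lexx.
  have [rs|sr] := ltP r s; first exact: Es.
  rewrite -(subrKC s r); apply: step; first by rewrite subr_ge0.
  by move: rt; rewrite le_min => /andP[_]; lra.
move=> t t0; apply/eqP; rewrite eq_le g0// andbT; apply/ler_addgt0Pr => e e0.
(* [growth] is started at a small [a] with [g a < e'], so that its bound is at most
   [2 * e' * expR ((K + 1) * t) = e]. *)
rewrite add0r; pose e' := e / (2 * expR ((K + 1) * t)).
have e'0 : 0 < e' by rewrite divr_gt0// mulr_gt0// expR_gt0.
have [d d0 gd] := gzero _ e'0; pose a := Num.min t (d / 2).
have a0 : 0 < a by rewrite lt_min t0 divr_gt0.
have at_ : a <= t by rewrite ge_min lexx.
have /(gd a a0)ga : a < d by rewrite gt_min; apply/orP; right; lra.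
apply: le_trans (growth a t e' a0 at_ e'0) _.
have -> : e = 2 * e' * expR ((K + 1) * t) by rewrite /e'; field; rewrite gt_eqF ?expR_gt0.
apply: ler_pM; [by rewrite addr_ge0 ?g0// ltW|exact: expR_ge0| |].
  by lra.
by rewrite ler_expR ler_pM2l ?addr_gt0// gerBl ltW.
Qed.

(** * Intertwining of two semigroups on an invariant set *)

Section Intertwining.
Context {R : realType} {H1 H2 : hilbertType R}.
Context {S1 : R -> {linear H1 -> H1}} {S2 : R -> {linear H2 -> H2}}.

(* On [P] the difference [y t] of both sides satisfies [y' = G2 y] in the sense
   of right derivatives, and [y 0 = 0]; quasi-dissipativity of the generator [G2]
   makes [|y|^2] subject to Gronwall's inequality. *)
Lemma semigroup_intertwine (Phi : {linear H1 -> H2}) (omega : R) (P : set H1) :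
  C0_semigroup S1 -> C0_semigroup S2 -> continuous Phi ->
  (forall y, dom (generator S2) y ->
    rdot (generator S2 y) y <= omega * hnorm y ^+ 2) ->
  (forall x t, P x -> 0 < t -> P (S1 t x)) ->
  (forall x, P x -> dom (generator S1) x /\ dom (generator S2) (Phi x) /\
    generator S2 (Phi x) = Phi (generator S1 x)) ->
  forall x t, P x -> 0 < t -> S2 t (Phi x) = Phi (S1 t x).
Proof.
move=> C1 C2 cPhi diss PS PG x t0 Px t0_gt0.
have [B B0 PhiB] := continuous_linearP cPhi.
pose y t := S2 t (Phi x) - Phi (S1 t x).
have [xd1 [Phixd2 _]] := PG x Px.
suff /(_ t0 t0_gt0)/eqP : forall t, 0 < t -> hnorm (y t) ^+ 2 = 0.
  by rewrite sqrf_eq0 => /eqP/hnorm0_eq0/eqP; rewrite subr_eq0 => /eqP.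
have Phi_le u v : hnorm (u - Phi v) <= hnorm u + B * hnorm v.
  by apply: le_trans (hnormB_le _ _) _; rewrite lerD2l.
(* The derivative of [|y|^2] is at most [2 omega |y|^2]; adding 1 makes the constant positive. *)
apply: (@gronwall_right _ _ (2 * `|omega| + 1)).
- by rewrite ltr_wpDl// mulr_ge0.
- by move=> t _; exact: sqr_ge0.
- move=> s e s0 e0; have y0 := hnorm_ge0 (y s).
  (* If [p' < p], then [p^2 - p'^2 = (p - p') (p + p') <= 2 eta p <= e], where [p] and [p'] are the
     norms of [y s] and [y t]. *)
  pose eta := e / (2 * (hnorm (y s) + 1)).
  have eta0 : 0 < eta by rewrite divr_gt0// mulr_gt0// ltr_wpDl.
  have [da da0 Sa] := semigroup_left_continuous C2 (Phi x) s0 (divr_gt0 eta0 (ltr0Sn _ 1)).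
  have [db db0 Sb] := semigroup_left_continuous C1 x s0
    (divr_gt0 eta0 (mulr_gt0 (ltr0Sn _ 1) B0)).
  exists (Num.min da db) => [|t t_gt0 ts]; first by rewrite lt_min da0 db0.
  rewrite ltrBlDr -ltrBlDl lt_min !ltrBlDl -!ltrBlDr.
  move=> /andP[/(Sa t t_gt0 ts)ha /(Sb t t_gt0 ts)hb].
  have yst : hnorm (y s - y t) < eta.
    have -> : y s - y t = (S2 s (Phi x) - S2 t (Phi x)) - Phi (S1 s x - S1 t x).
      by rewrite (linearB Phi) /y opprD addrACA -opprD.
    apply: le_lt_trans (Phi_le _ _) _; rewrite [eta]splitr; apply: ltrD => //.
    by rewrite -ltr_pdivlMl// mulrC -mulrA -invfM.
  have := hnorm_dist3 (y s) (y t) 0; rewrite !subr0.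
  have : eta * hnorm (y s) <= e / 2.
    rewrite /eta -mulrA ler_pM2l// ler_pdivrMl ?mulr_gt0 ?ltr_wpDl//.
    by lra.
  move: yst (hnorm_ge0 (y t)) y0; set p := hnorm (y s); set p' := hnorm (y t).
  set d := hnorm _ => dlt p'0 p0 ep ppd.
  have [pp'|p'p] := leP p p'; first by nra.
  have : (p - p') * (p + p') <= eta * (p + p).
    by apply: ler_pM; lra.
  by lra.
- move=> t e t_gt0 e0.
  have [xt1 Gxt1] := generator_semigroup C1 t_gt0 xd1.
  have [d2 G2] := generator_semigroup C2 t_gt0 Phixd2.
  have [_ [d2' G2']] := PG _ (PS _ _ Px t_gt0).
  have [yd yG] := generatorB d2 d2'; rewrite -/(y t) in yd yG.
  set G := generator S2 (y t) in yG.
  have G0 := hnorm_ge0 G; have y0 := hnorm_ge0 (y t).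
  (* In [|y t + h q|^2 = |y t|^2 + 2 h (q, y t) + h^2 |q|^2], replacing [q] by [G] in the middle
     term costs at most [2 h eta |y t| <= h e / 2]. The cap 1 gives [|q| <= |G| + 1], so that [dc]
     bounds the last term by [h e / 2]. *)
  pose eta := Num.min 1 (e / (4 * (hnorm (y t) + 1))).
  have eta0 : 0 < eta by rewrite lt_min ltr01 divr_gt0// mulr_gt0// ltr_wpDl.
  have [da da0 qa] := generator_near d2 (divr_gt0 eta0 (ltr0Sn _ 1)).
  have [db db0 qb] := generator_near xt1 (divr_gt0 eta0 (mulr_gt0 (ltr0Sn _ 1) B0)).
  pose dc := e / (2 * (hnorm G + 1) ^+ 2).
  have dc0 : 0 < dc by rewrite divr_gt0// mulr_gt0// exprn_gt0// ltr_wpDl.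
  exists (Num.min dc (Num.min da db)); first by rewrite !lt_min dc0 da0 db0.
  move=> h h0; rewrite !lt_min => /and3P[hc /(qa h h0)ha /(qb h h0)hb].
  pose q := (h^-1)%:C *: (y (t + h) - y t).
  have ytq : y (t + h) = y t + h%:C *: q.
    by rewrite scalerA -rmorphM/= mulfV ?gt_eqF// rmorph1 scale1r subrKC.
  (* Since [S1 t x] stays in [P], the error splits into that of [S2] at [S2 t (Phi x)] and the image
     under [Phi] of that of [S1] at [S1 t x]. *)
  have qG : hnorm (q - G) < eta.
    have -> : q - G = ((h^-1)%:C *: (S2 h (S2 t (Phi x)) - S2 t (Phi x)) -
          generator S2 (S2 t (Phi x))) -
        Phi ((h^-1)%:C *: (S1 h (S1 t x) - S1 t x) - generator S1 (S1 t x)).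
      rewrite yG G2' (linearB Phi) linear_real (linearB Phi).
      rewrite [in RHS]opprD [RHS]addrACA -opprD -scalerBr; congr (_ *: _ - _).
      rewrite /y [t + h]addrC !semigroupD//.
      by rewrite opprD addrACA -opprD.
    apply: le_lt_trans (Phi_le _ _) _; rewrite [eta]splitr; apply: ltrD => //.
    by rewrite -ltr_pdivlMl// mulrC -mulrA -invfM.
  have qle : hnorm q <= hnorm G + 1.
    have := hnorm_dist3 q G 0; rewrite !subr0; move: qG; rewrite lt_min => /andP[].
    by set a := hnorm _; set b := hnorm _; lra.
  have rle : rdot q (y t) <= omega * hnorm (y t) ^+ 2 + eta * hnorm (y t).
    rewrite -[q](subrK G) rdotDl addrC lerD ?diss//.
    by apply: le_trans (rdot_le _ _) _; rewrite ler_wpM2r// ltW.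
  rewrite ytq hnorm_sqrD rdotZr hnormZr gtr0_norm// exprMn rdotC.
  have eta_le : eta * hnorm (y t) <= e / 4.
    apply: le_trans (_ : e / (4 * (hnorm (y t) + 1)) * hnorm (y t) <= _).
      by rewrite ler_wpM2r// ge_min lexx orbT.
    rewrite -mulrA ler_pM2l// ler_pdivrMl ?mulr_gt0 ?ltr_wpDl//.
    by lra.
  have hq : h * hnorm q ^+ 2 <= e / 2.
    apply: le_trans (_ : dc * (hnorm G + 1) ^+ 2 <= _).
      apply: ler_pM; rewrite ?sqr_ge0 ?(ltW h0) ?(ltW hc)//.
      by rewrite ler_pXn2r ?nnegrE ?hnorm_ge0 ?addr_ge0.
    have G1 : hnorm G + 1 != 0 by rewrite gt_eqF// ltr_wpDl.
    by rewrite le_eqVlt; apply/orP; left; apply/eqP; rewrite /dc; field.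
  have om : omega * hnorm (y t) ^+ 2 <= `|omega| * hnorm (y t) ^+ 2.
    by rewrite ler_wpM2r ?sqr_ge0// ler_norm.
  have hhq : h * (h * hnorm q ^+ 2) <= h * (e / 2) by rewrite ler_pM2l.
  have hr : h * rdot q (y t) <= h * (`|omega| * hnorm (y t) ^+ 2 + e / 4).
    by rewrite ler_pM2l//; lra.
  have : 0 <= h * hnorm (y t) ^+ 2 by rewrite mulr_ge0 ?sqr_ge0 ?(ltW h0).
  move: hhq hr; set a := hnorm q; set b := rdot _ _; set c := hnorm _; set o := `|_|.
  by lra.
(* The cap 1 ensures [|y|^2 <= |y|]. *)
- move=> e e0; pose eta := Num.min 1 e.
  have eta0 : 0 < eta by rewrite lt_min ltr01.
  have [da da0 Sa] := semigroup_cvg0 C2 (Phi x) (divr_gt0 eta0 (ltr0Sn _ 1)).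
  have [db db0 Sb] := semigroup_cvg0 C1 x (divr_gt0 eta0 (mulr_gt0 (ltr0Sn _ 1) B0)).
  exists (Num.min da db) => [|t t_gt0]; first by rewrite lt_min da0 db0.
  rewrite lt_min => /andP[/(Sa t t_gt0)ha /(Sb t t_gt0)hb].
  have : hnorm (y t) < eta.
    have -> : y t = (S2 t (Phi x) - Phi x) - Phi (S1 t x - x).
      by rewrite (linearB Phi) opprB subrKA.
    apply: le_lt_trans (Phi_le _ _) _; rewrite [eta]splitr; apply: ltrD => //.
    by rewrite -ltr_pdivlMl// mulrC -mulrA -invfM.
  rewrite lt_min => /andP[y1 ye]; apply: le_lt_trans ye.
  by rewrite expr2 ler_piMl ?hnorm_ge0// ltW.
Qed.

End Intertwining.

(** * Spectral theory of compact symmetric operators, and total sets *)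

Lemma le0_of_small {R : realFieldType} (a C : R) : 0 <= C ->
  (forall e, 0 < e -> a <= C * e) -> a <= 0.
Proof.
move=> C0 aC; rewrite leNgt; apply/negP => a0.
have C1 : 0 < 2 * (C + 1) by rewrite mulr_gt0// ltr_wpDl.
have := aC _ (divr_gt0 a0 C1).
rewrite mulrA ler_pdivlMr//.
by nra.
Qed.

Section Spectral.
Context {R : realType} {H : hilbertType R}.

(** The vectors [x n / C] lie in the unit ball, so their images cluster at some [p], and the
    [K (x n)] at [C p]. *)
Lemma compact_operator_cluster (K : {linear H -> H}) (x : nat -> H) (C : R) :
  compact_operator K -> 0 < C -> (forall n, hnorm (x n) <= C) ->
  exists y, forall (e : R) N, 0 < e ->
    exists2 n, (N <= n)%N & hnorm (K (x n) - y) < e.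
Proof.
rewrite /compact_operator precompactE => cK C0 xC.
pose u n := K (C^-1%:C *: x n).
have [|p [_ pcl]] := cK (u @ \oo) _.
  exists 0%N => // n _; apply: subset_closure; exists (C^-1%:C *: x n) => //=.
  by rewrite hnormE -[1](rmorph1 (real_complex R)) lecR hnormZr gtr0_norm ?invr_gt0//
    ler_pdivrMl// mulr1.
exists (C%:C *: p) => e N e0.
have eC : 0 < e / C by rewrite divr_gt0.
have [||_ [[n Nn <-]]] := pcl (u @` [set n | (N <= n)%N])
    (fun v => hnorm (p - v) < e / C).
- by exists N => // n Nn; exists n.
- apply/nbhs_ballP; exists (e / C)%:C => /=; first by rewrite ltcR.
  by move=> v; rewrite -ball_normE /= hnormE ltcR.
rewrite /u linear_real => pn; exists n => //.
have -> : K (x n) - C%:C *: p = C%:C *: (C^-1%:C *: K (x n) - p).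
  by rewrite scalerBr scalerA -rmorphM/= mulfV ?gt_eqF// rmorph1 scale1r.
by rewrite hnormZr gtr0_norm// -ltr_pdivlMl// mulrC hnormB.
Qed.

(* The supremum [m] of the Rayleigh quotient over the orthogonal complement of
   the eigenvectors would be attained at an eigenvector: by Cauchy-Schwarz for
   the positive form [(T x, y)], a maximizing sequence satisfies
   [|T x - m x|^2 <= m (m - (T x, x)) -> 0]. *)
Lemma compact_selfadjoint_total (T : H -> H) (B : R) (z : H) :
  (forall x y, T (x + y) = T x + T y) ->
  (forall (r : R) x, T (r%:C *: x) = r%:C *: T x) ->
  0 <= B -> (forall x, hnorm (T x) <= B * hnorm x) ->
  (forall x y, rdot (T x) y = rdot x (T y)) ->
  (forall x, x != 0 -> 0 < rdot (T x) x) ->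
  (forall x : nat -> H, (forall n, hnorm (x n) <= 1) ->
    exists y, forall (e : R) N, 0 < e ->
      exists2 n, (N <= n)%N & hnorm (T (x n) - y) < e) ->
  (forall (m : R) y, 0 < m -> T y = m%:C *: y -> rdot y z = 0) ->
  z = 0.
Proof.
move=> TD TZ B0 TB Tsym Tpos Tcomp Nz; apply: contrapT => /eqP z0.
have TBr x y : T (x - y) = T x - T y.
  by have := TZ (-1) y; rewrite TD rmorphN1 !scaleN1r => ->.
(* The orthogonal complement of the eigenvectors with positive eigenvalue; symmetry makes it
   invariant under [T]. *)
pose N x := forall (m : R) y, 0 < m -> T y = m%:C *: y -> rdot y x = 0.
have NT x : N x -> N (T x).
  by move=> Nx m y m0 Ty; rewrite -Tsym Ty rdotZl (Nx m)// mulr0.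
have NZ (r : R) x : N x -> N (r%:C *: x).
  by move=> Nx m y m0 Ty; rewrite rdotZr (Nx m)// mulr0.
pose E := [set r | exists x, [/\ N x, hnorm x = 1 & r = rdot (T x) x]].
have unit x : x != 0 -> hnorm ((hnorm x)^-1%:C *: x) = 1.
  rewrite -hnorm_gt0 => x0.
  by rewrite hnormZr gtr0_norm ?invr_gt0// mulVf ?gt_eqF.
have Ez : E (rdot (T ((hnorm z)^-1%:C *: z)) ((hnorm z)^-1%:C *: z)).
  by exists ((hnorm z)^-1%:C *: z); split; [exact: NZ Nz|exact: unit|by []].
have hE : has_sup E.
  split; [by eexists; exact: Ez|exists B => _ [x [_ x1 ->]]].
  by apply: le_trans (rdot_le _ _) _; rewrite x1 mulr1; have := TB x; rewrite x1 mulr1.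
have [_ ubE] := hE; set m := sup E.
have m0 : 0 < m.
  apply: lt_le_trans (ub_le_sup ubE Ez); apply: Tpos.
  by apply/eqP => /(congr1 hnorm); rewrite unit// hnorm0; apply/eqP; rewrite oner_eq0.
have Tm x : N x -> rdot (T x) x <= m * hnorm x ^+ 2.
  move=> Nx; have [->|x0] := eqVneq x 0.
    by rewrite rdot0r hnorm0 expr0n mulr0.
  have n0 : 0 < hnorm x by rewrite hnorm_gt0.
  have /(ub_le_sup ubE) : E (rdot (T ((hnorm x)^-1%:C *: x)) ((hnorm x)^-1%:C *: x)).
    by exists ((hnorm x)^-1%:C *: x); split; [exact: NZ Nx|exact: unit|by []].
  rewrite TZ rdotZl rdotZr mulrA -invfM -expr2 mulrC ler_pdivrMr ?exprn_gt0//.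
(* Positivity of [T] at [m x - T x] reads [0 <= m^2 (T x, x) - 2 m |T x|^2 + (T T x, T x)], and the
   last term is at most [m |T x|^2] because [T x] is again in [N]. *)
have Tsq x : N x -> hnorm (T x) ^+ 2 <= m * rdot (T x) x.
  move=> Nx; have : 0 <= rdot (T (m%:C *: x - T x)) (m%:C *: x - T x).
    have [->|/Tpos/ltW//] := eqVneq (m%:C *: x - T x) 0.
    by rewrite rdot0r.
  rewrite TBr TZ !rdotBl !rdotBr !rdotZl !rdotZr (Tsym (T x) x) !rdot_norm.
  have := Tm _ (NT _ Nx); move: (rdot (T (T x)) (T x)) (rdot (T x) x) (hnorm (T x)).
  move=> a b c ac h; have : m * c ^+ 2 <= m * (m * b) by nra.
  by rewrite ler_pM2l.
have /choice[x xP] (n : nat) : exists x,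
    [/\ N x, hnorm x = 1 & m - n.+1%:R^-1 < rdot (T x) x].
  have n0 : (0 : R) < n.+1%:R^-1 by rewrite invr_gt0.
  by have [_ [x [Nx x1 ->]] ?] := sup_adherent n0 hE; exists x.
have [n|y xy] := Tcomp x; first by have [_ -> _] := xP n.
have approx (e : R) : 0 < e -> exists x, [/\ N x, hnorm x = 1,
    hnorm (T x - y) < e & hnorm (T x - m%:C *: x) < e].
  move=> e0; have [M Mn] := invn_lt (divr_gt0 (exprn_gt0 2 e0) m0).
  have [n /Mn nM xny] := xy e M e0; have [Nx x1 xm] := xP n.
  exists (x n); split => //.
  rewrite -(ltr_pXn2r (ltn0Sn 1)) ?nnegrE ?hnorm_ge0 ?(ltW e0)//.
  have mn : m - rdot (T (x n)) (x n) < e ^+ 2 / m.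
    by apply: lt_trans nM; rewrite ltrBlDr -ltrBlDl.
  rewrite ltr_pdivlMr// in mn.
  rewrite hnorm_sqrB rdotZr hnormZr gtr0_norm// x1 mulr1.
  by have := Tsq _ Nx; nra.
have Ny : N y.
  move=> c v c0 Tv; apply/eqP; rewrite -normr_le0.
  apply: (@le0_of_small _ _ (hnorm v)); first exact: hnorm_ge0.
  move=> e /approx[w [Nw _ wy _]].
  have -> : rdot v y = rdot v (y - T w).
    by rewrite rdotBr (NT _ Nw c)// subr0.
  apply: le_trans (rdot_abs_le _ _) _.
  by rewrite ler_wpM2l ?hnorm_ge0// hnormB ltW.
have Ty : T y = m%:C *: y.
  apply/eqP; rewrite -subr_eq0; apply/eqP/hnorm0_eq0/eqP.
  rewrite eq_le hnorm_ge0 andbT; apply: (@le0_of_small _ _ (2 * B + m)).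
    by rewrite addr_ge0 ?mulr_ge0 ?(ltW m0).
  move=> e /approx[w [_ _ wy ww]].
  have -> : T y - m%:C *: y =
      T (y - T w) + T (T w - m%:C *: w) + m%:C *: (T w - y).
    by rewrite !TBr TZ scalerBr addrA subrKA subrK.
  apply: le_trans (hnormD_le _ _) _; rewrite hnormZr gtr0_norm// mulrDl lerD//.
    apply: le_trans (hnormD_le _ _) _; rewrite -mulrA mulr_natl mulr2n.
    apply: lerD; apply: le_trans (TB _) _; rewrite ler_wpM2l//; last exact: ltW.
    by rewrite hnormB ltW.
  by rewrite ler_wpM2l ?ltW.
(* Being in [N] and satisfying [T y = m y], the vector [y] is orthogonal to itself. But [y] is
   within any [e] of some [T w], itself close to [m w] with [|w| = 1], so its norm would have to be
   [m]. *)
have y0 : hnorm y = 0.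
  by apply/eqP; rewrite -sqrf_eq0 -rdot_norm (Ny m).
have [w [_ w1 wy ww]] := approx _ (divr_gt0 m0 (ltr0Sn _ 1)).
have := hnorm_dist3 (m%:C *: w) (T w) y; rewrite (hnorm0_eq0 y0) !subr0.
rewrite (hnorm0_eq0 y0) subr0 in wy; rewrite hnormB hnormZr gtr0_norm// w1 mulr1.
by move: wy ww; set a := hnorm _; set b := hnorm _; lra.
Qed.

(** With [y = f x - g x], the functional [v |-> rdot (f v - g v) y] is represented by a vector
    orthogonal to [E], hence is 0; its value at [x] is [|y|^2]. *)
Lemma agree_on_total {H' : hilbertType R} (E : set H) (f g : {linear H -> H'}) :
  (forall z, (forall e, E e -> rdot e z = 0) -> z = 0) ->
  continuous f -> continuous g -> (forall e, E e -> f e = g e) ->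
  forall x, f x = g x.
Proof.
move=> Etot /continuous_linearP[B B0 fB] /continuous_linearP[C C0 gC] fg x.
set y := f x - g x.
have [u v|r u|u|w phiw] := @riesz_real _ _ (fun v => rdot (f v - g v) y)
    ((B + C) * hnorm y).
- by rewrite -rdotDl (linearD f) (linearD g) opprD addrACA.
- by rewrite /= (linear_real f) (linear_real g) -[_ - _]scalerBr rdotZl.
- apply: le_trans (rdot_le _ _) _; rewrite mulrAC ler_wpM2r ?hnorm_ge0//.
  by apply: le_trans (hnormB_le _ _) _; rewrite mulrDl lerD.
have w0 : w = 0.
  apply: Etot => e Ee; rewrite rdotC -phiw fg// subrr.
  exact: rdot0l.
have : hnorm y ^+ 2 = 0.
  by rewrite -rdot_norm {1}/y phiw w0 rdot0l.
move/eqP; rewrite sqrf_eq0 => /eqP/hnorm0_eq0/eqP.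
by rewrite /y subr_eq0 => /eqP.
Qed.

End Spectral.

(** * Elliptic forms and their associated operators *)

Lemma continuous_form_bounded {R : realType} {V : hilbertType R}
    (a : sesquilinear_form V) : continuous_form a ->
  exists2 C : R, 0 < C & forall u v, complex.Re (a u v) <= C * hnorm u * hnorm v.
Proof.
move=> /(_ (0, 0)); rewrite /continuous_at /= linear0l => /cvgrPdist_lt/(_ 1 ltr01).
move=> /nbhs_ballP[e /= e0 ea].
have /RRe_real eE : e \is Num.real by exact: gtr0_real.
have d0 : 0 < complex.Re e by rewrite -ltcR eE.
set d := complex.Re e in eE d0.
(* Both arguments are scaled to norm [d / 2], inside the ball where the form is below 1 in
   modulus. *)
exists (4 / d ^+ 2) => [|u v]; first by rewrite divr_gt0// exprn_gt0.
have aZ (r s : R) : complex.Re (a (r%:C *: u) (s%:C *: v)) =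
    r * s * complex.Re (a u v).
  by rewrite linearZl_LR linearZr_LR /= ReZr; case: (a u v) => x y /=; ring.
have [->|u0] := eqVneq u 0; first by rewrite linear0l hnorm0 mulr0 mul0r.
have [->|v0] := eqVneq v 0; first by rewrite linear0r hnorm0 mulr0.
have n0 (w : V) : w != 0 -> 0 < hnorm w by rewrite hnorm_gt0.
have small (w : V) : w != 0 -> ball (0 : V) e ((d / 2 / hnorm w)%:C *: w).
  move=> /n0 w0; rewrite -ball_normE /= sub0r normrN hnormE -eE ltcR hnormZr.
  by rewrite gtr0_norm ?divr_gt0// divfK ?gt_eqF// ltr_pdivrMr// ltr_pMr// ltr1n.
have := ea ((d / 2 / hnorm u)%:C *: u, (d / 2 / hnorm v)%:C *: v).
move=> /(_ (conj (small _ u0) (small _ v0))) /=; rewrite sub0r normrN => a1.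
have {a1} : complex.Re (a ((d / 2 / hnorm u)%:C *: u) ((d / 2 / hnorm v)%:C *: v)) <= 1.
  rewrite -lecR; apply: le_trans (ltW a1); apply: le_trans (normc_ge_Re _).
  by rewrite lecR ler_norm.
rewrite aZ; have := n0 _ u0; have := n0 _ v0.
move: (hnorm u) (hnorm v) (complex.Re _) => p q r q0 p0 pq.
have K0 : 0 < d / 2 / p * (d / 2 / q) by rewrite mulr_gt0 ?divr_gt0.
rewrite -(ler_pM2l K0); apply: le_trans pq _.
by rewrite le_eqVlt; apply/orP; left; apply/eqP; field; rewrite !gt_eqF.
Qed.

(** For [j v] within [e] of [z], [|z|^2 = (z, z - j v) <= |z| e]. *)
Lemma dense_rdot_eq0 {R : realType} {V H : hilbertType R} (j : V -> H) (z : H) :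
  dense (range j) -> (forall v, rdot z (j v) = 0) -> z = 0.
Proof.
move=> jd jz; apply: hnorm0_eq0; apply/eqP; rewrite eq_le hnorm_ge0 andbT.
apply: (@le0_of_small _ _ 1) => // e e0; rewrite mul1r.
have eC : 0 < e%:C by rewrite ltcR.
have [||x [xb [v _ vx]]] := jd (ball z e%:C).
- by exists z; exact: ballxx.
- exact: ball_open.
move: xb; rewrite -{}vx -ball_normE /= hnormE ltcR => ze.
have [->|z0] := eqVneq z 0; first by rewrite hnorm0 ltW.
have n0 : 0 < hnorm z by rewrite hnorm_gt0.
rewrite -(ler_pM2l n0) -expr2 -rdot_norm -[leLHS]subr0 -(jz v) -rdotBr.
by apply: le_trans (rdot_le _ _) _; rewrite ler_pM2l// ltW.
Qed.

Section AssociatedOperator.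
Context {R : realType} {V H : hilbertType R} {j : {linear V -> H}}.
Context {a : sesquilinear_form V}.
Hypothesis hj : dense_embedding j.
Hypothesis ca : continuous_form a.
Context {omega mu : R}.
Hypothesis mu0 : 0 < mu.
Hypothesis coercive : forall u : V,
  mu%:C * `|u| ^+ 2 <= 'Re (a u u) + omega%:C * `|j u| ^+ 2.

Local Notation A := (associated_operator j a).
Local Notation graph := (associated_graph j a).

Let coerciveR u : mu * hnorm u ^+ 2 <= complex.Re (a u u) + omega * hnorm (j u) ^+ 2.
Proof.
have := coercive u; rewrite -complexRe !hnormE -!rmorphXn/= -!rmorphM/= -rmorphD/=.
by rewrite lecR.
Qed.

Let inj0 u : j u = 0 -> u = 0.
Proof. by case: hj => _ ji _; rewrite -(linear0 j) => /ji. Qed.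

Lemma graphD x y f g : graph x f -> graph y g -> graph (x + y) (f + g).
Proof.
move=> [u <- uf] [v <- vg]; exists (u + v); first by rewrite linearD.
by move=> w; rewrite linearDl uf vg linearDl.
Qed.

Lemma graphZ (c : R[i]) x f : graph x f -> graph (c *: x) (c *: f).
Proof.
move=> [u <- uf]; exists (c *: u); first by rewrite linearZ.
by move=> w; rewrite linearZl_LR uf linearZl_LR.
Qed.

Lemma graphB x y f g : graph x f -> graph y g -> graph (x - y) (f - g).
Proof.
move=> xf yg; rewrite -[- y]scaleN1r -[- g]scaleN1r.
by apply: graphD => //; exact: graphZ.
Qed.

(** The pair [(0, f - g)] is in the graph; injectivity of [j] gives [u = 0], so [f - g] is
    orthogonal to the dense range of [j]. *)
Lemma graph_uniq x f g : graph x f -> graph x g -> f = g.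
Proof.
move=> xf xg; have [u] := graphB xf xg; rewrite subrr => /inj0-> ufg.
apply/eqP; rewrite -subr_eq0; apply/eqP; case: hj => _ _ /dense_rdot_eq0; apply=> v.
by rewrite /rdot -ufg linear0l.
Qed.

Lemma graph_dom x : dom A x -> graph x (A x).
Proof. by move=> [f xf]; apply: (@xgetPex _ 0 [set f | graph x f]); exists f. Qed.

Lemma graph_app x f : graph x f -> dom A x /\ A x = f.
Proof.
move=> xf; have dx : dom A x by exists f.
by split => //; exact: graph_uniq (graph_dom dx) xf.
Qed.

Lemma graph_coercive x f : graph x f -> exists2 u, j u = x &
  mu * hnorm u ^+ 2 <= rdot f x + omega * hnorm x ^+ 2.
Proof.
by move=> [u <- uf]; exists u => //; have := coerciveR u; rewrite uf.
Qed.

Lemma associated_dissipative x : dom A x -> rdot (- A x) x <= omega * hnorm x ^+ 2.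
Proof.
move=> /graph_dom/graph_coercive[u _].
have : 0 <= mu * hnorm u ^+ 2 by rewrite mulr_ge0 ?sqr_ge0 ?(ltW mu0).
by rewrite rdotNl; lra.
Qed.

Lemma shifted_graph_inj x : graph x (- (omega%:C *: x)) -> x = 0.
Proof.
move=> /graph_coercive[u <-]; rewrite rdotNl rdotZl rdot_norm addNr.
rewrite pmulr_rle0// => u0; suff -> : u = 0 by rewrite linear0.
by apply/hnorm0_eq0/eqP; rewrite -sqrf_eq0 eq_le u0 sqr_ge0.
Qed.

(** The statement says [(omega + A) x = f]. Lax-Milgram applies to the real part of the form shifted
    by [omega], which is coercive by ellipticity. *)
Lemma shifted_graph_surj f : exists x, graph x (f - omega%:C *: x).
Proof.
have [C C0 aC] := continuous_form_bounded ca.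
have [c c0 jc] := continuous_linearP (let: And3 jc _ _ := hj in jc).
pose b u v := complex.Re (a u v) + omega * rdot (j u) (j v).
have [u u' v|r u v|u v v'|r u v|u v||u|u v|r u|u|u ub] :=
  @lax_milgram_real _ _ b (fun v => rdot f (j v)) (C + `|omega| * c * c)
    (hnorm f * c) mu.
- by rewrite /b linearDl raddfD/= linearD rdotDl; ring.
- by rewrite /b linearZl_LR/= ReZr linear_real rdotZl; ring.
- by rewrite /b linearDr raddfD/= linearD rdotDr; ring.
- rewrite /b linearZr_LR/= linear_real rdotZr; case: (a u v) => p q /=; ring.
- rewrite /b !mulrDl lerD//.
  apply: le_trans (ler_norm _) _; rewrite normrM -!mulrA ler_wpM2l//.
  apply: le_trans (rdot_abs_le _ _) _.
  rewrite [leRHS](_ : _ = c * hnorm u * (c * hnorm v)); last by ring.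
  by apply: ler_pM; rewrite ?hnorm_ge0.
- exact: mu0.
- by rewrite /b rdot_norm.
- by rewrite linearD rdotDr.
- by rewrite linear_real rdotZr.
- apply: le_trans (rdot_le _ _) _; rewrite -mulrA ler_wpM2l ?hnorm_ge0//.
exists (j u), u => // v; apply/eqP; rewrite -subr_eq0; apply/eqP.
have ub' w : complex.Re (a u w - inner (f - omega%:C *: j u) (j w)) = 0.
  have : complex.Re (a u w) = rdot (f - omega%:C *: j u) (j w).
    by rewrite rdotBl rdotZl -[rdot f _]ub /b addrK.
  by rewrite raddfB/= => ->; rewrite /rdot subrr.
(* So far only real parts agree; testing on [i v] as well gives the imaginary parts. *)
have := ub' ('i%C *: v); have := ub' v.
rewrite [j (_ *: _)]linearZ_LR !linearZr_LR /= -mulrBr Re_conji.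
by move=> zr zi; rewrite [LHS]complexE zr zi rmorph0 mulr0 addr0.
Qed.

(** [T] is [(omega + A)^{-1}]; its linearity is later read off from the uniqueness clause. *)
Lemma form_resolvent : exists T : H -> H,
  [/\ forall f, graph (T f) (f - omega%:C *: T f),
      forall x f, graph x (f - omega%:C *: x) -> x = T f,
      exists2 B : R, 0 < B & forall f, hnorm (T f) <= B * hnorm f &
      forall f, f != 0 -> 0 < rdot (T f) f].
Proof.
have [T gT] := choice shifted_graph_surj; exists T; split=> //.
- move=> x f xf; apply/eqP; rewrite -subr_eq0; apply/eqP.
  apply: shifted_graph_inj => //; have := graphB xf (gT f).
  by rewrite opprB [_ - _ + _]addrC subrKA scalerBr opprB.
- have [c c0 jc] := continuous_linearP (let: And3 jc _ _ := hj in jc).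
  (* With [T f = j u]: [mu |u|^2 <= (f, T f) <= c |f| |u|], and the embedding contributes the second
     factor [c]. *)
  exists (c * (c / mu)) => [|f]; first by rewrite !mulr_gt0 ?invr_gt0.
  have [u uf] := graph_coercive (gT f).
  rewrite rdotBl rdotZl rdot_norm subrK -uf => uf'.
  apply: le_trans (jc u) _; rewrite -mulrA ler_pM2l//.
  rewrite mulrAC ler_pdivlMr// mulrC.
  have := hnorm_ge0 u; rewrite le_eqVlt => /predU1P[<-|u0].
    by rewrite mulr0 mulr_ge0 ?hnorm_ge0 ?(ltW c0).
  rewrite -(ler_pM2r u0) -mulrA -expr2; apply: le_trans uf' _.
  apply: le_trans (rdot_le _ _) _; rewrite mulrC mulrAC.
  by rewrite ler_wpM2r ?hnorm_ge0.
- move=> f f0; have [u uf] := graph_coercive (gT f).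
  rewrite rdotBl rdotZl rdot_norm subrK rdotC => /(lt_le_trans _); apply.
  rewrite mulr_gt0// exprn_gt0// hnorm_gt0; apply: contra f0 => /eqP u0.
  (* If [u = 0], then [T f = 0] and the graph contains [(0, f)], so [f = 0] by uniqueness. *)
  have g0 : graph 0 0 by exists 0; [exact: linear0|move=> v; rewrite !linear0l].
  have := gT f; rewrite -uf u0 linear0 scaler0 subr0 => gf.
  by rewrite (graph_uniq gf g0).
Qed.

(** Tested on [x = T z]: [(T z, z)] is positive unless [z = 0]. *)
Lemma associated_dom_total z : (forall x, dom A x -> rdot x z = 0) -> z = 0.
Proof.
have [T [gT _ _ Tpos]] := form_resolvent => Az; apply/eqP/negPn/negP => /Tpos.
by rewrite Az ?ltxx//; have [] := graph_app (gT z).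
Qed.

(** [T = (omega + A)^{-1}] inherits symmetry from [A] and has the same eigenvectors, so the
    statement for compact symmetric operators applies to it. *)
Lemma eigenvectors_total z : self_adjoint A -> has_compact_resolvent A ->
  (forall (lambda : R) x, dom A x -> A x = lambda%:C *: x -> rdot x z = 0) -> z = 0.
Proof.
move=> [_ [adom aapp]] [lambda [K [[cK _ KA] compK]]] Az.
have [T [gT uT [B B0 TB] Tpos]] := form_resolvent.
have Asym x y : dom A x -> dom A y -> rdot (A x) y = rdot x (A y).
  move=> dx dy; have dy' : dom (adjoint A) y by rewrite adom.
  rewrite -(aapp _ dy'); case: dy' => g yg.
  congr complex.Re.
  exact: (@xgetPex _ 0 [set g | forall u, dom A u -> inner (A u) y = inner u g]
    (ex_intro _ g yg)).
have Tdom f : dom A (T f) /\ A (T f) = f - omega%:C *: T f by exact: graph_app (gT f).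
apply: (@compact_selfadjoint_total _ _ T B z).
- move=> x y; apply/esym/uT; have := graphD (gT x) (gT y).
  by rewrite addrACA -opprD -scalerDr.
- move=> r x; apply/esym/uT; have := graphZ r%:C (gT x).
  by rewrite scalerBr !scalerA [r%:C * _]mulrC.
- exact: ltW.
- exact: TB.
- move=> x y; have [dx Ax] := Tdom x; have [dy Ay] := Tdom y.
  have := Asym _ _ dx dy; rewrite Ax Ay rdotBl rdotBr rdotZl rdotZr.
  by move=> /(congr1 (fun r => r + omega * rdot (T x) (T y))); rewrite !subrK.
- exact: Tpos.
- move=> x x1.
  (* [T (x n) = K (y n)] with [y] bounded, so that [T] is compact with [K]. *)
  pose y n := lambda *: T (x n) - A (T (x n)).
  have lambda0 : 0 <= complex.Re `|lambda| by rewrite -ler0c RRe_real ?normr_real.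
  have TxB n : hnorm (T (x n)) <= B.
    by apply: le_trans (TB _) _; rewrite ler_piMr// ltW.
  have yC n : hnorm (y n) <= complex.Re `|lambda| * B + (1 + `|omega| * B).
    rewrite /y; have [_ ->] := Tdom (x n).
    apply: le_trans (hnormB_le _ _) _; rewrite hnormZ lerD ?ler_wpM2l//.
    apply: le_trans (hnormB_le _ _) _.
    by rewrite hnormZr lerD// ler_wpM2l.
  have [|p pP] := compact_operator_cluster compK _ yC.
    by rewrite ltr_wpDl ?mulr_ge0 ?(ltW B0)// ?ltr_pwDl ?mulr_ge0 ?(ltW B0)//.
  exists p => e N /(pP e N)[n Nn]; rewrite KA; last by have [] := Tdom (x n).
  by exists n.
- move=> m y m0 Ty.
  (* [T y = m y] amounts to [A y = (1 / m - omega) y]. *)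
  have : graph y ((m^-1 - omega)%:C *: y).
    have := graphZ m^-1%:C (gT y); rewrite Ty.
    rewrite scalerBr !scalerA mulrCA -rmorphM/= mulVf ?gt_eqF// rmorph1 mulr1 scale1r.
    by rewrite -scalerBl -rmorphB.
  by move=> /graph_app[]; exact: Az.
Qed.

End AssociatedOperator.

(** * From intertwined semigroups back to generators, and the equivalences *)

Lemma generator_intertwine {R : realType} {H1 H2 : hilbertType R}
    {S1 : R -> {linear H1 -> H1}} {S2 : R -> {linear H2 -> H2}}
    (Phi : {linear H1 -> H2}) (x : H1) : continuous Phi ->
  (forall t y, 0 < t -> S2 t (Phi y) = Phi (S1 t y)) ->
  dom (generator S1) x ->
  dom (generator S2) (Phi x) /\ generator S2 (Phi x) = Phi (generator S1 x).
Proof.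
move=> /continuous_linearP[B B0 PhiB] SPhi xd; apply: generator_cvg.
apply/cvg_hnormP => e e0; apply/near_at_right0.
have [d d0 xg] := generator_near xd (divr_gt0 e0 B0).
exists d => // t t0 td; rewrite SPhi// -linearB/= -linear_real -linearB/=.
by apply: le_lt_trans (PhiB _) _; rewrite -ltr_pdivlMl// mulrC; exact: xg.
Qed.

Theorem corollary2p3 (R : realType) (H1 H2 V1 V2 : hilbertType R)
    (j1 : {linear V1 -> H1}) (j2 : {linear V2 -> H2})
    (hj1 : dense_embedding j1) (hj2 : dense_embedding j2)
    (a1 : sesquilinear_form V1) (a2 : sesquilinear_form V2)
    (ha1 : continuous_form a1) (ha2 : continuous_form a2)
    (ea1 : elliptic j1 a1) (ea2 : elliptic j2 a2)
    (S1 : R -> {linear H1 -> H1}) (S2 : R -> {linear H2 -> H2})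
    (hS1 : semigroup_generated_by (opp_operator (associated_operator j1 a1)) S1)
    (hS2 : semigroup_generated_by (opp_operator (associated_operator j2 a2)) S2)
    (Phi : {linear H1 -> H2}) (PhiV : {linear H2 -> H1})
    (hPhi : continuous Phi) (hPhiV : continuous PhiV)
    (PhiK : cancel Phi PhiV) (PhiVK : cancel PhiV Phi) :
  let A1 := associated_operator j1 a1 in
  let A2 := associated_operator j2 a2 in
  let i := Phi @` dom A1 `<=` dom A2 /\
    (forall u, dom A1 u -> A2 (Phi u) = Phi (A1 u)) in
  let ii := Phi @` dom A1 = dom A2 /\
    (forall u, dom A1 u -> A2 (Phi u) = Phi (A1 u)) in
  let iii := forall t : R, 0 < t -> forall x, PhiV (S2 t (Phi x)) = S1 t x in
  let iv := forall (u : H1) (lambda : R),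
    dom A1 u -> A1 u = lambda%:C *: u ->
    dom A2 (Phi u) /\ A2 (Phi u) = lambda%:C *: Phi u in
  [/\ [<-> i; ii; iii], i -> iv &
      self_adjoint A1 -> has_compact_resolvent A1 -> [<-> i; ii; iii; iv]].

Proof.
move=> A1 A2 i ii iii iv.
have [omega1 [mu1 [mu1_gt0 co1]]] := ea1; have [omega2 [mu2 [mu2_gt0 co2]]] := ea2.
case: hS1 => C1 [dom1 app1]; case: hS2 => C2 [dom2 app2].
have {}dom1 : dom (generator S1) = dom A1 := dom1.
have {}dom2 : dom (generator S2) = dom A2 := dom2.
have {}app1 u : dom A1 u -> generator S1 u = - A1 u by rewrite -dom1; exact: app1.
have {}app2 u : dom A2 u -> generator S2 u = - A2 u by rewrite -dom2; exact: app2.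
have A1S x t : 0 < t -> dom A1 x -> dom A1 (S1 t x) /\ A1 (S1 t x) = S1 t (A1 x).
  move=> t0 dx; have [] := generator_semigroup C1 t0 (x := x); rewrite dom1// => dSx.
  by rewrite !app1// linearN => /oppr_inj.
have intertwine (P : set H1) : (forall x t, P x -> 0 < t -> P (S1 t x)) ->
    (forall x, P x -> [/\ dom A1 x, dom A2 (Phi x) & A2 (Phi x) = Phi (A1 x)]) ->
    forall x t, P x -> 0 < t -> S2 t (Phi x) = Phi (S1 t x).
  move=> PS PA; apply: (@semigroup_intertwine _ _ _ _ _ _ omega2) => //.
    rewrite dom2 => y dy; rewrite app2//.
    exact: (associated_dissipative mu2_gt0 co2 dy).
  move=> x /PA[dx dPx AP]; rewrite dom1 dom2; split=> //; split=> //.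
  by rewrite app1// app2// AP linearN.
(* For fixed [t] both sides are bounded linear in [x], so agreement on a total set suffices. *)
have extend (E : set H1) : (forall z, (forall e, E e -> rdot e z = 0) -> z = 0) ->
    (forall x t, E x -> 0 < t -> S2 t (Phi x) = Phi (S1 t x)) -> iii.
  move=> Etot ES t t0 x; apply: (can_inj PhiK); rewrite PhiVK.
  apply: (@agree_on_total _ _ _ E (S2 t \o Phi) (Phi \o S1 t)) => //.
  - case: C2 => /(_ t t0) S2c _ _ y.
    by apply: continuous_comp; [exact: hPhi|exact: S2c].
  - case: C1 => /(_ t t0) S1c _ _ y.
    by apply: continuous_comp; [exact: S1c|exact: hPhi].
  - by move=> e Ee /=; exact: ES.
have i_iii : i -> iii.
  move=> [Pd PA]; apply: (extend (dom A1)).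
    by move=> z; apply: (associated_dom_total hj1 ha1 mu1_gt0 co1).
  apply: intertwine => [x t dx t0|x dx]; first by have [] := A1S x t t0 dx.
  by split=> //; [apply: Pd; exists x|exact: PA].
have iii_ii : iii -> ii.
  move=> S12.
  have SPhi t y : 0 < t -> S2 t (Phi y) = Phi (S1 t y).
    by move=> t0; rewrite -(S12 t t0) PhiVK.
  have SPhiV t y : 0 < t -> S1 t (PhiV y) = PhiV (S2 t y).
    by move=> t0; rewrite -(S12 t t0) PhiVK.
  have PA u : dom A1 u -> dom A2 (Phi u) /\ A2 (Phi u) = Phi (A1 u).
    rewrite -dom1 => du; have [] := generator_intertwine hPhi SPhi du.
    rewrite dom2 => dPu; rewrite app2// app1 -?dom1// linearN.
    by move=> /oppr_inj.
  split; last by move=> u /PA[].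
  apply/seteqP; split=> [_ [u du <-]|v]; first by have [] := PA u du.
  (* The inverse [PhiV] intertwines the semigroups in the other direction, so [PhiV v] is the
     preimage of [v] in the domain of [A1]. *)
  rewrite -dom2 => dv; have [+ _] := generator_intertwine hPhiV SPhiV dv.
  by rewrite dom1 => dPv; exists (PhiV v) => //; exact: PhiVK.
have ii_i : ii -> i by move=> [domE PA]; split=> //; rewrite domE.
have i_iv : i -> iv.
  move=> [Pd PA] u lambda du Au; split; first by apply: Pd; exists u.
  by rewrite PA// Au linearZ.
split=> //.
  tfae; [by move=> /i_iii/iii_ii|by move=> /ii_i/i_iii|by move=> /iii_ii/ii_i].
move=> sa cr.
have iv_iii : iv -> iii.
  move=> eig.
  (* Totality concerns the union of all eigenspaces, whereas [intertwine] is applied to one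
     eigenspace at a time, each being invariant under [S1]. *)
  apply: (extend [set x | exists lambda : R, dom A1 x /\ A1 x = lambda%:C *: x]).
    move=> z Ez; apply: (eigenvectors_total hj1 ha1 mu1_gt0 co1 sa cr) => lambda x dx Ax.
    by apply: Ez; exists lambda.
  move=> x t [lambda Ex]; move: x t Ex.
  apply: (intertwine [set x | dom A1 x /\ A1 x = lambda%:C *: x]) => [x t [dx Ax] t0|x [dx Ax]].
    by have [dS AS] := A1S x t t0 dx; split=> //; rewrite AS Ax linearZ.
  by have [dP AP] := eig _ _ dx Ax; split=> //; rewrite AP Ax linearZ.
tfae; [by move=> /i_iii/iii_ii|by move=> /ii_i/i_iii|by move=> /iii_ii/ii_i/i_iv|].
by move=> /iv_iii/iii_ii/ii_i.
Qed.
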